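(* Let $\mathbf{M}=(M_0,M_1,\ldots,M_k)$, $M_i\in\mathbb{R}^{n\times n}$, be such that all diagonal entries of every $M_i$ are positive. Let $\Lambda_i$ be the diagonal part of $M_i$ and write $M_i=\Lambda_i-C_i$, $i=0,1,\ldots,k$. Suppose $$\rho\Big(\max_{0\le i\le k}\{\Lambda_i^{-1}|C_i|\}\Big)<1.$$ Then $$\alpha_\ell(\mathbf{M})\le\|\gamma_\ell\|,\qquad \ell=0,1,\ldots,k,$$ where $$\gamma_\ell=\Big(I-\max_{0\le i\le k}\{\Lambda_i^{-1}|C_i|\}\Big)^{-1}\Lambda_\ell^{-1}.$$
   Context: $|A|$ is the entrywise absolute value of a matrix; $\max_{0\le i\le k}\{A_i\}$ is the entrywise maximum of the matrices $A_0,\ldots,A_k$; $\rho$ is the spectral radius. $\mathcal{D}$ is the set of all tuples $(D_0,\ldots,D_k)$ of $n\times n$ diagonal matrices with diagonal entries in $[0,1]$ and $\sum_{i=0}^kD_i=I$. For $(D_0,\ldots,D_k)\in\mathcal{D}$ put $S_{\mathbf{M}}=\sum_{i=0}^kD_iM_i$ (nonsingular for every such tuple under the stated hypotheses), and $\alpha_\ell(\mathbf{M})=\max_{(D_0,\ldots,D_k)\in\mathcal{D}}\|S_{\mathbf{M}}^{-1}D_\ell\|$ for $\ell=0,\ldots,k$. $\|\cdot\|$ denotes the matrix operator norm induced by a fixed vector $p$-norm with $p\ge 1$ ($p=\infty$ allowed). *)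

(* Defs.v *)
From mathcomp Require Import all_boot all_order all_algebra.
From mathcomp Require Import complex.
From mathcomp Require Import all_classical all_reals all_analysis.

Set Implicit Arguments.
Unset Strict Implicit.
Unset Printing Implicit Defensive.

Import Order.TTheory GRing.Theory Num.Theory.
Local Open Scope classical_set_scope.
Local Open Scope ring_scope.

Section Defs.
Variable R : realType.

Definition absmx (m n : nat) (A : 'M[R]_(m, n)) : 'M[R]_(m, n) :=
  map_mx Num.norm A.

(* The default element of the fold is the (0, i, j) entry itself, so that this
   is the genuine maximum also for negative entries. *)
Definition maxmx (k m n : nat) (A : 'I_k.+1 -> 'M[R]_(m, n)) : 'M[R]_(m, n) :=
  \matrix_(i, j) \big[Num.max/A ord0 i j]_(t < k.+1) A t i j.

Definition diag_part (n : nat) (A : 'M[R]_n) : 'M[R]_n :=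
  diag_mx (\row_i A i i).

(* A = diag_part A - offdiag_part A; note the sign. *)
Definition offdiag_part (n : nat) (A : 'M[R]_n) : 'M[R]_n := diag_part A - A.

(* The eigenvalues range over the complex numbers, hence the embedding of A
   into the matrices over R[i]; the norm of R[i] takes its (real) values in
   R[i], hence Re. The spectrum is finite, so this sup is a maximum for n > 0;
   it is 0 for n = 0. *)
Definition spectral_radius (n : nat) (A : 'M[R]_n) : R :=
  sup [set complex.Re `|z| | z in
       [set z : R[i] | eigenvalue (map_mx (real_complex R) A) z]].

(* Only meant for 1 <= p <= +oo. *)
Definition pnorm (p : \bar R) (n : nat) (x : 'cV[R]_n) : R :=
  match p with
  | r%:E => (\sum_i `|x i ord0| `^ r) `^ r^-1
  | +oo%E => \big[Num.max/0]_i `|x i ord0|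
  | -oo%E => 0
  end.

Definition opnorm (p : \bar R) (m n : nat) (A : 'M[R]_(m, n)) : R :=
  sup [set pnorm p (A *m x) | x in [set x : 'cV[R]_n | pnorm p x <= 1]].

Definition diag_weights (k n : nat) : set ('I_k.+1 -> 'M[R]_n) :=
  [set D | (forall i : 'I_k.+1, is_diag_mx (D i)) /\
           (forall (i : 'I_k.+1) (j : 'I_n), 0 <= D i j j <= 1) /\
           \sum_i D i = 1%:M].

Definition Smx (k n : nat) (M D : 'I_k.+1 -> 'M[R]_n) : 'M[R]_n :=
  \sum_i D i *m M i.

(* When all Smx M D are nonsingular, D |-> opnorm p (invmx (Smx M D) *m D l) is
   continuous on the nonempty compact set diag_weights, so this supremum is a
   finite maximum. It is taken in \bar R so that an upper bound on alpha is
   always a bound on every member of the set, with no default value involved. *)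
Definition alpha (p : \bar R) (k n : nat) (M : 'I_k.+1 -> 'M[R]_n)
    (l : 'I_k.+1) : \bar R :=
  ereal_sup [set (opnorm p (invmx (Smx M D) *m D l))%:E |
             D in @diag_weights k n].

Definition scaled_max (k n : nat) (M : 'I_k.+1 -> 'M[R]_n) : 'M[R]_n :=
  maxmx (fun i => invmx (diag_part (M i)) *m absmx (offdiag_part (M i))).

Definition gamma_mx (k n : nat) (M : 'I_k.+1 -> 'M[R]_n) (l : 'I_k.+1) :
    'M[R]_n :=
  invmx (1%:M - scaled_max M) *m invmx (diag_part (M l)).

End Defs.

(* Main.v *)
Require Import Defs.
From mathcomp Require Import all_boot all_order all_algebra.
From mathcomp Require Import complex ring lra.
From mathcomp Require Import all_classical all_reals all_analysis.

(** Write B for the entrywise maximum of the matrices Lambda_i^-1 |C_i|, a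
    nonnegative matrix of spectral radius less than 1.

    Everything rests on the fact that I - B is monotone: (I - B) y >= 0 forces
    y >= 0 ([supersolution_ge0]).  Since every eigenvalue has modulus less than
    1, det (I - s B) does not vanish for s in [0, 1]; following the solution of
    (I - s B) q = det (I - s B) 1 from s = 0 to s = 1, its entries stay
    positive, because as long as q >= 0 the equation itself gives
    q >= det (I - s B) 1 > 0.  At s = 1 this is a positive vector x with B x < x
    ([exists_strict_supersolution]), and monotonicity follows by comparing y
    with the multiples of x.

    Given weights D and Lambda_D = sum_i D_i Lambda_i, the triangle inequality
    and |C_i| <= Lambda_i B give
      Lambda_D (|y| - B |y|) <= |S y|        ([residual_bound]).
    With S y = 0, monotonicity yields y = 0, so S is nonsingular.  With
    S y = D_l x and D_l Lambda_l <= Lambda_D, it gives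
    (I - B) |y| <= Lambda_l^-1 |x|, hence
      |S^-1 D_l x| <= gamma_l |x|            ([weighted_solution_bound]).
    The p-norms depend monotonically on the absolute values of the entries, so
    this entrywise domination passes to the operator norms
    ([opnorm_le_dominated]). *)

Set Implicit Arguments.
Unset Strict Implicit.
Unset Printing Implicit Defensive.

Import Order.TTheory GRing.Theory Num.Theory.
Import numFieldNormedType.Exports.
Local Open Scope ring_scope.

(** * Linear algebra *)

Lemma unitmx_inj (F : fieldType) (n : nat) (A : 'M[F]_n) :
  (forall y : 'cV[F]_n, A *m y = 0 -> y = 0) -> A \in unitmx.
Proof.
move=> injA; rewrite unitmxE unitfE -det_tr; apply/negP => /det0P[v v0 vA].
have vT0 : v^T = 0 by apply: injA; rewrite -[A]trmxK -trmx_mul vA trmx0.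
by move: v0; rewrite -[v]trmxK vT0 trmx0 eqxx.
Qed.

Lemma diag_mulmxE (R : pzRingType) (m n : nat) (D : 'M[R]_n) (A : 'M[R]_(n, m))
    a b :
  is_diag_mx D -> (D *m A) a b = D a a * A a b.
Proof. by move=> /diag_mxP[d ->]; rewrite mul_diag_mx !mxE eqxx mulr1n. Qed.

(** * Monotonicity of I - B when the spectral radius of B is less than 1 *)

(** The supremum defining the spectral radius is meaningful because the
    eigenvalues are the finitely many roots of the characteristic polynomial;
    the sum of their moduli is a crude upper bound. *)
Lemma eigenvalue_le_spectral_radius (R : realType) (n : nat) (A : 'M[R]_n)
    (z : R[i]) :
  eigenvalue (map_mx (real_complex R) A) z ->
  complex.Re `|z| <= spectral_radius A.
Proof.
move=> zA; apply: ub_le_sup; last by exists z.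
have Re0 (w : R[i]) : 0 <= complex.Re `|w| by rewrite normc_def /= sqrtr_ge0.
have [rs charE] :=
  closed_field_poly_normal (char_poly (map_mx (real_complex R) A)).
exists (\sum_(w <- rs) complex.Re `|w|) => _ [w /= + <-].
rewrite eigenvalue_root_char charE (monicP (char_poly_monic _)) scale1r.
rewrite root_prod_XsubC => wrs.
by rewrite (big_rem w) //= lerDl; apply: sumr_ge0 => u _; exact: Re0.
Qed.

(** A kernel vector of I - s B is an eigenvector of B for the eigenvalue
    1 / s >= 1. *)
Lemma det_sub_scale_neq0 (R : realType) (n : nat) (B : 'M[R]_n) (s : R) :
  spectral_radius B < 1 -> 0 <= s <= 1 -> \det (1%:M - s *: B) != 0.
Proof.
move=> rB /andP[s0 s1]; apply/negP => /det0P[v v0].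
rewrite mulmxBr mulmx1 -scalemxAr => /eqP; rewrite subr_eq0 => /eqP vE.
have sN0 : s != 0.
  by apply: contraNneq v0 => sE; rewrite vE sE scale0r.
have eB : eigenvalue (map_mx (real_complex R) B) (real_complex R s^-1).
  apply/eigenvalueP; exists (map_mx (real_complex R) v).
    by rewrite -map_mxM -map_mxZ {2}vE scalerA mulVf // scale1r.
  by rewrite map_mx_eq0.
have := eigenvalue_le_spectral_radius eB.
rewrite normc_def /= expr0n addr0 sqrtr_sqr ger0_norm ?invr_ge0 // leNgt.
suff -> : spectral_radius B < s^-1 by [].
apply: (lt_le_trans rB).
by rewrite -invr1 lef_pV2 ?posrE ?lt_def ?sN0 ?oner_neq0 //=.
Qed.

(** The solution of (I - s B) q = det (I - s B) 1 supplied by the adjugate is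
    polynomial in s, hence continuous, and can be followed along [0, 1].  The
    minimum f of det (I - s B) and of the entries of q is continuous, equals 1
    at s = 0, and is positive wherever it is nonnegative on [0, 1]; it
    therefore cannot cross zero. *)
Lemma exists_strict_supersolution (R : realType) (n : nat) (B : 'M[R]_n) :
  (forall i j, 0 <= B i j) -> spectral_radius B < 1 ->
  exists x : 'cV[R]_n,
    forall i, 0 < x i ord0 /\ (B *m x) i ord0 < x i ord0.
Proof.
move=> B0 rB.
pose P : 'M[{poly R}]_n := 1%:M - 'X *: map_mx polyC B.
pose q := \adj P *m (const_mx 1 : 'cV_n).
have evalP (s : R) : map_mx (horner_eval s) P = 1%:M - s *: B.
  rewrite /P map_mxB map_mx1 map_mxZ /= /horner_eval hornerX -map_mx_comp.
  congr (_ - _ *: _); apply/matrixP => i j.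
  by rewrite !mxE /= /horner_eval hornerC.
have detE (s : R) : (\det P).[s] = \det (1%:M - s *: B).
  by rewrite -evalP det_map_mx.
have qE (s : R) i :
    (q i ord0).[s] - s * (B *m map_mx (horner_eval s) q) i ord0 = (\det P).[s].
  have : (1%:M - s *: B) *m map_mx (horner_eval s) q = const_mx (\det P).[s].
    rewrite -evalP -map_mxM mulmxA mul_mx_adj mul_scalar_mx.
    by apply/matrixP => a b; rewrite !mxE mulr1.
  rewrite mulmxBl mul1mx -scalemxAl => /matrixP/(_ i ord0).
  by rewrite !mxE.
pose f (s : R) : R := \big[Num.min/(\det P).[s]]_i (q i ord0).[s].
(* When q >= 0, each entry satisfies
   q_i = det (I - s B) + s (B q)_i >= det (I - s B). *)
have f_gt0 (s : R) : 0 <= s <= 1 -> 0 <= f s -> 0 < (\det P).[s] <= f s.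
  move=> s01 /bigmin_geP[d0 q0].
  have dgt0 : 0 < (\det P).[s].
    by rewrite lt_def d0 detE det_sub_scale_neq0.
  rewrite dgt0; apply/bigmin_geP; split=> // i _.
  rewrite -(qE s i) lerBlDr lerDl mulr_ge0 //; first by case/andP: s01.
  rewrite mxE sumr_ge0 // => j _; rewrite mulr_ge0 // mxE; exact: q0.
have cf : continuous f.
  have -> : f = \big[(fun g h : R -> R => g \min h)/horner (\det P)]_i
      horner (q i ord0).
    by apply/funext => s; rewrite /f; elim/big_rec2: _ => //= i y g _ ->.
  apply: (big_ind (fun g : R -> R => continuous g)) => [|g h cg ch s|i _].
  - exact: continuous_horner.
  - by apply: continuous_min; [exact: cg|exact: ch].
  - exact: continuous_horner.
have d0 : (\det P).[0] = 1 by rewrite detE scale0r subr0 det1.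
have f0 : 0 < f 0.
  rewrite /f; elim/big_ind: _ => [|a b a0 b0|i _]; first by rewrite d0.
    by rewrite lt_min a0.
  by have := qE 0 i; rewrite mul0r subr0 d0 => ->.
have f1 : 0 <= f 1.
  rewrite leNgt; apply/negP => f1.
  have [||s s01 fs] := @IVT R f 0 1 0 ler01.
  - exact: continuous_subspaceT.
  - by rewrite ge_min le_max (ltW f0) (ltW f1) orbT.
  move: s01; rewrite in_itv /= => s01.
  have := f_gt0 s s01; rewrite fs lexx => /(_ isT)/andP[ds_gt0 ds_le0].
  by rewrite lt_geF in ds_le0.
have /andP[d1 /bigmin_geP[_ q1]] : 0 < (\det P).[1] <= f 1.
  by apply: f_gt0 => //; rewrite ler01 lexx.
exists (map_mx (horner_eval 1) q) => i; split.
  by rewrite mxE; apply: (lt_le_trans d1); exact: q1.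
by rewrite -subr_gt0 -[X in _ - X]mul1r [X in X - _]mxE /horner_eval qE.
Qed.

(** Take x > 0 with B x < x and let i minimize y_i / x_i, with minimum r.  Then
    y >= r x, so if r < 0 we would get
    (B y)_i >= r (B x)_i > r x_i = y_i. *)
Lemma supersolution_ge0 (R : realType) (n : nat) (B : 'M[R]_n) (y : 'cV[R]_n) :
  (forall i j, 0 <= B i j) -> spectral_radius B < 1 ->
  (forall i, (B *m y) i ord0 <= y i ord0) -> forall i, 0 <= y i ord0.
Proof.
move=> B0 rB yB i0.
have [x xB] := exists_strict_supersolution B0 rB.
have x_ge0 j : 0 <= x j ord0 by case: (xB j) => /ltW.
pose r i := y i ord0 / x i ord0.
case: (@arg_minP _ _ _ i0 xpredT r isT) => i _ min_i.
have yE j : y j ord0 = r j * x j ord0.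
  by rewrite /r mulfVK // gt_eqF //; case: (xB j).
suff ri : 0 <= r i.
  by rewrite yE mulr_ge0 // (le_trans ri) ?min_i.
rewrite leNgt; apply/negP => ri.
have : r i * x i ord0 < r i * (B *m x) i ord0.
  by rewrite ltr_nM2l //; case: (xB i).
rewrite -yE ltNge (le_trans _ (yB i)) // !mxE mulr_sumr.
apply: ler_sum => j _; rewrite mulrCA ler_wpM2l // (yE j).
by rewrite ler_wpM2r ?min_i.
Qed.

(** * Vector p-norms and operator norms *)

Lemma pnorm_le (R : realType) (p : \bar R) (n : nat) (x y : 'cV[R]_n) :
  (1 <= p)%E -> (forall i, `|x i ord0| <= `|y i ord0|) ->
  pnorm p x <= pnorm p y.
Proof.
case: p => [r| |] //= hp xy; last by apply: le_bigmax2 => i _; exact: xy.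
have r0 : 0 <= r by move: hp; rewrite lee_fin; apply: le_trans.
have s0 (z : 'cV[R]_n) : \sum_i `|z i ord0| `^ r \in Num.nneg.
  by rewrite nnegrE sumr_ge0 // => i _; rewrite powR_ge0.
apply: ge0_ler_powR; rewrite ?invr_ge0 ?s0 //.
by apply: ler_sum => i _; apply: ge0_ler_powR; rewrite ?nnegrE.
Qed.

Lemma pnorm0 (R : realType) (p : \bar R) (n : nat) :
  (1 <= p)%E -> pnorm p (0 : 'cV[R]_n) = 0.
Proof.
case: p => [r| |] //= hp.
  have r0 : r != 0.
    by rewrite gt_eqF //; move: hp; rewrite lee_fin; apply: lt_le_trans.
  rewrite big1 ?powR0 ?invr_neq0 // => i _.
  by rewrite mxE normr0 powR0.
by elim/big_ind: _ => // [a b -> ->|i _]; rewrite ?maxxx // mxE normr0.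
Qed.

Lemma entry_le_pnorm (R : realType) (p : \bar R) (n : nat) (x : 'cV[R]_n) i :
  (1 <= p)%E -> `|x i ord0| <= pnorm p x.
Proof.
case: p => [r| |] //= hp; last exact: le_bigmax.
have r0 : 0 < r by move: hp; rewrite lee_fin; apply: lt_le_trans.
have -> : `|x i ord0| = (`|x i ord0| `^ r) `^ r^-1.
  by rewrite -powRrM divff ?gt_eqF // powRr1.
apply: ge0_ler_powR; rewrite ?invr_ge0 ?(ltW r0) ?nnegrE ?powR_ge0 //.
  by rewrite sumr_ge0 // => j _; rewrite powR_ge0.
by rewrite (bigD1 i) //= lerDl sumr_ge0 // => j _; rewrite powR_ge0.
Qed.

(** The point is that the supremum defining the operator norm is over a bounded
    set: each entry of a vector in the unit ball is at most 1 in absolute value,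
    so the norm of the vector of row sums of |A| is an upper bound. *)
Lemma pnorm_mulmx_le_opnorm (R : realType) (p : \bar R) (m n : nat)
    (A : 'M[R]_(m, n)) (x : 'cV[R]_n) :
  (1 <= p)%E -> pnorm p x <= 1 -> pnorm p (A *m x) <= opnorm p A.
Proof.
move=> hp x1; apply: ub_le_sup; last by exists x.
exists (pnorm p (\col_i \sum_j `|A i j|)) => _ [y /= y1 <-].
apply: pnorm_le => // i; rewrite !mxE; apply: le_trans (ler_norm _).
apply: (le_trans (ler_norm_sum _ _ _)); apply: ler_sum => j _.
rewrite normrM ler_piMr //; exact: le_trans (entry_le_pnorm _ _ hp) y1.
Qed.

(** Replacing x by |x| does not change its norm, so |x| is an admissible test
    vector for G. *)
Lemma opnorm_le_dominated (R : realType) (p : \bar R) (m n : nat)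
    (A G : 'M[R]_(m, n)) :
  (1 <= p)%E ->
  (forall (x : 'cV[R]_n) i,
     `|(A *m x) i ord0| <= (G *m absmx x) i ord0) ->
  opnorm p A <= opnorm p G.
Proof.
move=> hp AG; apply: ge_sup.
  by exists (pnorm p (A *m 0)), 0 => //=; rewrite pnorm0.
move=> _ [x /= x1 <-].
apply: (@le_trans _ _ (pnorm p (G *m absmx x))).
  by apply: pnorm_le => // i; exact: le_trans (AG _ _) (ler_norm _).
apply: pnorm_mulmx_le_opnorm => //; apply: le_trans x1.
by apply: pnorm_le => // i; rewrite mxE normr_id.
Qed.

(** * The weighted matrices S_M *)

Section WeightedMatrices.
Variables (R : realType) (n k : nat) (M : 'I_k.+1 -> 'M[R]_n).
Hypothesis M_gt0 : forall i j, 0 < M i j j.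

Let B := scaled_max M.

Lemma invmx_diag_part_mulE (m : nat) i (A : 'M[R]_(n, m)) a b :
  (invmx (diag_part (M i)) *m A) a b = A a b / M i a a.
Proof.
have uD : diag_part (M i) \in unitmx.
  rewrite unitmxE unitfE det_diag; apply/prodf_neq0 => j _.
  by rewrite mxE gt_eqF.
have /matrixP/(_ a b) := mulKVmx uD A.
by rewrite mul_diag_mx !mxE => <-; rewrite mulrAC divff ?mul1r ?gt_eqF // mulr1.
Qed.

Lemma scaled_entry_le i a b :
  `|offdiag_part (M i) a b| <= M i a a * B a b.
Proof.
rewrite mulrC -ler_pdivrMr // /B /scaled_max [leRHS]mxE.
apply: le_trans (le_bigmax _ _ i).
by rewrite invmx_diag_part_mulE [X in _ <= X / _]mxE.
Qed.

Lemma scaled_max_ge0 a b : 0 <= B a b.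
Proof.
by rewrite -(pmulr_rge0 _ (M_gt0 ord0 a)) (le_trans _ (scaled_entry_le _ _ _)).
Qed.

(** Row a of S y = Lambda_D y - sum_i D_i C_i y, with the bound
    |C_i| <= Lambda_i B making the off-diagonal part at most Lambda_D B |y|. *)
Lemma residual_bound (D : 'I_k.+1 -> 'M[R]_n) (y : 'cV[R]_n) a :
  diag_weights D ->
  (\sum_i D i a a * M i a a) * (`|y a ord0| - (B *m absmx y) a ord0)
    <= `|(Smx M D *m y) a ord0|.
Proof.
move=> [Ddiag [D01 _]].
have SE : (Smx M D *m y) a ord0 =
    \sum_i D i a a * M i a a * y a ord0
    - \sum_i D i a a * (offdiag_part (M i) *m y) a ord0.
  rewrite -sumrB /Smx mulmx_suml summxE; apply: eq_bigr => i _.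
  rewrite -mulmxA diag_mulmxE // /offdiag_part mulmxBl /diag_part mul_diag_mx.
  rewrite [X in _ = _ - _ * X]mxE [X in _ = _ - _ * (X + _)]mxE.
  rewrite [X in _ = _ - _ * (_ + X)]mxE [X in _ = _ - _ * (X * _ + _)]mxE.
  ring.
rewrite mulrBr lerBlDr.
have -> : (\sum_i D i a a * M i a a) * `|y a ord0| =
    `|\sum_i D i a a * M i a a * y a ord0|.
  rewrite -mulr_suml normrM ger0_norm // sumr_ge0 // => i _.
  by rewrite mulr_ge0 ?(ltW (M_gt0 _ _)) //; case/andP: (D01 i a).
have -> : \sum_i D i a a * M i a a * y a ord0 =
    (Smx M D *m y) a ord0 + \sum_i D i a a * (offdiag_part (M i) *m y) a ord0.
  by rewrite SE subrK.
apply: (le_trans (ler_normD _ _)); rewrite lerD2l mulr_suml.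
apply: (le_trans (ler_norm_sum _ _ _)); apply: ler_sum => i _.
have /andP[d0 _] := D01 i a.
rewrite normrM (ger0_norm d0) -mulrA ler_wpM2l //.
rewrite [X in `|X|]mxE [X in _ * X]mxE mulr_sumr.
apply: (le_trans (ler_norm_sum _ _ _)); apply: ler_sum => j _.
by rewrite normrM mulrA [absmx _ _ _]mxE ler_wpM2r // scaled_entry_le.
Qed.

(** The weights in row a are nonnegative and sum to 1, so they do not all
    vanish. *)
Lemma weighted_diag_gt0 (D : 'I_k.+1 -> 'M[R]_n) a :
  diag_weights D -> 0 < \sum_i D i a a * M i a a.
Proof.
move=> [_ [D01 /matrixP/(_ a a)]]; rewrite summxE mxE eqxx => D1.
have t0 i : 0 <= D i a a * M i a a.
  by rewrite mulr_ge0 ?(ltW (M_gt0 _ _)) //; case/andP: (D01 i a).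
rewrite lt_def sumr_ge0 // andbT; apply/eqP.
move=> /psumr_eq0P - /(_ (fun i _ => t0 i)) z.
move: D1; rewrite big1 => [/esym/eqP|i _]; first by rewrite oner_eq0.
by have /eqP := z i isT; rewrite mulf_eq0 (gt_eqF (M_gt0 i a)) orbF => /eqP.
Qed.

Hypothesis rB : spectral_radius B < 1.

Lemma sub_scaled_max_unit : 1%:M - B \in unitmx.
Proof.
rewrite unitmxE unitfE -[B]scale1r det_sub_scale_neq0 //.
by rewrite ler01 lexx.
Qed.

(** Monotonicity applied to -|y|. *)
Lemma abs_subsolution_eq0 (y : 'cV[R]_n) :
  (forall a, `|y a ord0| <= (B *m absmx y) a ord0) -> y = 0.
Proof.
move=> yB; apply/colP => a; rewrite [RHS]mxE; apply/eqP; rewrite -normr_le0.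
suff : 0 <= (- absmx y) a ord0 by rewrite !mxE oppr_ge0.
apply: (supersolution_ge0 scaled_max_ge0 rB) => b.
by rewrite mulmxN mxE [leRHS]mxE lerN2 [absmx _ _ _]mxE.
Qed.

Lemma Smx_unit (D : 'I_k.+1 -> 'M[R]_n) :
  diag_weights D -> Smx M D \in unitmx.
Proof.
move=> DW; apply: unitmx_inj => y Sy0; apply: abs_subsolution_eq0 => a.
have := @residual_bound D y a DW; rewrite Sy0 [X in _ <= `|X|]mxE normr0.
by rewrite pmulr_rle0 ?weighted_diag_gt0 // subr_le0.
Qed.

(** With z = gamma_l |x|, (I - B) z = Lambda_l^-1 |x| dominates (I - B) |y|, and
    monotonicity gives z >= |y|. *)
Lemma weighted_solution_bound (D : 'I_k.+1 -> 'M[R]_n) l (x : 'cV[R]_n) a :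
  diag_weights D ->
  `|(invmx (Smx M D) *m D l *m x) a ord0|
    <= (gamma_mx M l *m absmx x) a ord0.
Proof.
move=> DW; have := DW => -[Ddiag [D01 _]].
set y := _ *m x; set z := _ *m absmx x.
have Sy : Smx M D *m y = D l *m x.
  by rewrite /y -mulmxA mulKVmx ?Smx_unit.
have zE b : z b ord0 - (B *m z) b ord0 = `|x b ord0| / M l b b.
  have : (1%:M - B) *m z = invmx (diag_part (M l)) *m absmx x.
    by rewrite /z /gamma_mx -mulmxA mulKVmx // sub_scaled_max_unit.
  rewrite mulmxBl mul1mx => /matrixP/(_ b ord0).
  rewrite invmx_diag_part_mulE [absmx _ _ _]mxE => <-.
  by rewrite [RHS]mxE [X in _ = _ + X]mxE.
have yB b : `|y b ord0| - (B *m absmx y) b ord0 <= `|x b ord0| / M l b b.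
  rewrite ler_pdivlMr //; have := @residual_bound D y b DW.
  set u := _ - _; set s := \sum_i _.
  have -> : `|(Smx M D *m y) b ord0| = D l b b * `|x b ord0|.
    have /andP[d0 _] := D01 l b.
    by rewrite Sy diag_mulmxE // normrM ger0_norm.
  have dl : D l b b * M l b b <= s.
    rewrite /s (bigD1 l) //= lerDl sumr_ge0 // => i _.
    by rewrite mulr_ge0 ?(ltW (M_gt0 _ _)) //; case/andP: (D01 i b).
  have s0 : 0 < s by exact: weighted_diag_gt0.
  (* From D_l M_l <= s one gets u M_l <= |x| by cancelling D_l, which is
     legitimate: u > 0 and s u <= D_l |x| exclude D_l = 0. *)
  have [u0 _|u0 su] := leP u 0.
    by rewrite (le_trans _ (normr_ge0 _)) // pmulr_lle0.
  have /andP[d0 _] := D01 l b.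
  have dM : D l b b * (u * M l b b) <= D l b b * `|x b ord0|.
    apply: le_trans su; rewrite mulrCA [leRHS]mulrC ler_wpM2l //; exact: ltW.
  have dgt0 : 0 < D l b b.
    rewrite lt_def d0 andbT; apply: contraTneq su => ->.
    by rewrite mul0r -ltNge mulr_gt0.
  by rewrite ler_pM2l in dM.
have : 0 <= (z - absmx y) a ord0.
  apply: (supersolution_ge0 scaled_max_ge0 rB) => b.
  have := yB b; rewrite -zE mulmxBr => yzb.
  rewrite [leLHS]mxE [leRHS]mxE [X in _ + X <= _]mxE [X in _ <= _ + X]mxE.
  by rewrite [absmx y _ _]mxE; lra.
by rewrite mxE [X in _ + X]mxE [absmx _ _ _]mxE subr_ge0.
Qed.

End WeightedMatrices.

Theorem theorem3p4 (R : realType) (n k : nat) (p : \bar R)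
    (M : 'I_k.+1 -> 'M[R]_n)
    (hp : (1 <= p)%E)
    (hdiag : forall (i : 'I_k.+1) (j : 'I_n), 0 < M i j j)
    (hrho : spectral_radius (scaled_max M) < 1) :
  forall l : 'I_k.+1, (alpha p M l <= (opnorm p (gamma_mx M l))%:E)%E.
Proof.
move=> l; apply: ge_ereal_sup => _ [D DW <-]; rewrite lee_fin.
apply: opnorm_le_dominated => // x i.
exact: weighted_solution_bound.
Qed.
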